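(* Let $p$ be an odd prime and $\mathscr{L}_p=\mathcal{L}(GA_{2p},(-1,2))$. If $p=3$ then $\mathscr{L}_p$ is atomic (i.e. $\nu(\mathscr{L}_p)=6$), and otherwise $\nu(\mathscr{L}_p)=2$.
   Context: Let $p$ be an odd prime and let $K_{2p}$ have vertex set $\mathbb{Z}_p\times\{1,2\}$. For $i\in\mathbb{Z}_p$ let $f_i=\{(i+j,1)(i-j,1),\,(i+j,2)(i-j,2) : j\in\{1,\dots,(p-1)/2\}\}\cup\{(i,1)(i,2)\}$, and for $i\in\mathbb{Z}_p\setminus\{0\}$ let $g_i=\{(j,1)(i+j,2): j\in\mathbb{Z}_p\}$. Then $GA_{2p}=\{f_i\}\cup\{g_i\}$ is a $1$-factorisation of $K_{2p}$. For a $1$-factorisation $\mathcal{F}$ of $K_{n+1}$ with vertex set $V$ and distinct $x,y\in V$, let $h_{x,y}$ be the $1$-factor of $\mathcal{F}$ containing $xy$; for $v\in V$, $\mathcal{L}(\mathcal{F},v)$ is the Latin square with row, column and symbol set $V\setminus\{v\}$ with $\mathcal{L}(\mathcal{F},v)_{i,i}=i$ and, for $j\ne i$, $\mathcal{L}(\mathcal{F},v)_{i,j}=k$ where $kv\in h_{i,j}$. A Latin square of order $n$ is viewed as its set of entries $(\text{row},\text{column},\text{symbol})$; its conjugates are the six Latin squares obtained by uniformly permuting the three coordinates of all entries. A $2\times k$ subrectangle is a $2\times k$ submatrix whose two rows contain the same $k$ symbols; a row cycle of length $k$ is a $2\times k$ subrectangle containing no smaller such subrectangle; a Latin square of order $n$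 is row-Hamiltonian if all its row cycles have length $n$. $\nu(L)$ is the number of conjugates of $L$ that are row-Hamiltonian, and $L$ is atomic if $\nu(L)=6$. *)

(* Defs.v *)
From HB Require Import structures.
From mathcomp Require Import all_boot all_order all_algebra all_fingroup.

Set Implicit Arguments.
Unset Strict Implicit.
Unset Printing Implicit Defensive.

Import GRing.Theory.
Local Open Scope ring_scope.

(** A Latin square whose rows, columns and symbols are all indexed by [S] is a
    set of entries [tuple row; column; symbol]. *)
Section LatinSquares.

Variable S : finType.
Implicit Types (L : {set 3.-tuple S}) (r s : S) (C : {set S}).

Definition latin_square L : bool :=
  [&& [forall r, forall c, #|[set k | [tuple r; c; k] \in L]| == 1%N],
      [forall r, forall k, #|[set c | [tuple r; c; k] \in L]| == 1%N]
    & [forall c, forall k, #|[set r | [tuple r; c; k] \in L]| == 1%N]].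

Definition latin_conjugate (sigma : 'S_3) L : {set 3.-tuple S} :=
  [set [tuple tnth e (sigma i) | i < 3] | e in L].

Definition symbols L r C : {set S} :=
  [set k | [exists c in C, [tuple r; c; k] \in L]].

(** The [2 x #|C|] submatrix of [L] on the rows [r], [s] and the columns [C]. *)
Definition subrectangle L r s C : bool :=
  [&& r != s, C != set0 & symbols L r C == symbols L s C].

Definition row_cycle L r s C : bool :=
  subrectangle L r s C &&
  [forall D : {set S}, (D \proper C) ==> ~~ subrectangle L r s D].

Definition row_hamiltonian L : bool :=
  latin_square L &&
  [forall r, forall s, forall C : {set S},
     row_cycle L r s C ==> (#|C| == #|S|)].

(** The six conjugates are counted with multiplicity, i.e. indexed by the
    permutations of the coordinates: a symmetric square, for instance, equals
    its conjugate under the exchange of rows and columns, and both count. *)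
Definition nu L : nat :=
  #|[set sigma : 'S_3 | row_hamiltonian (latin_conjugate sigma L)]|.

Definition atomic L : Prop := nu L = 6%N.

End LatinSquares.

(** Edges of the complete graph on [V] are two-element sets of vertices,
    1-factors are sets of edges, and 1-factorisations are sets of 1-factors. *)
Section LatinSquareOfFactorisation.

Variable V : finType.
Implicit Types F : {set {set {set V}}}.

(** The default [set0] is never used when [F] is a 1-factorisation and
    [x != y]. *)
Definition factor_of F (x y : V) : {set {set V}} :=
  odflt set0 [pick h in F | [set x; y] \in h].

Definition factorisation_square F (v : V) :
    {set 3.-tuple {x : V | x != v}} :=
  [set e : 3.-tuple {x : V | x != v} |
    let i := tnth e 0 in let j := tnth e 1 in let k := tnth e 2%:R in
    if i == j then k == i
    else [set val k; v] \in factor_of F (val i) (val j)].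

End LatinSquareOfFactorisation.

(** For [p] prime, ['F_p] is the ring of integers modulo [p]; the label set
    [{1, 2}] is encoded by [false] for [1] and [true] for [2]. *)
Section GA.

Variable p : nat.

Definition GA_vertex : finType := ('F_p * bool)%type.

Definition pt1 (x : 'F_p) : GA_vertex := (x, false).
Definition pt2 (x : 'F_p) : GA_vertex := (x, true).

Definition GA_f (i : 'F_p) : {set {set GA_vertex}} :=
  [set [set pt1 (i + j%:R); pt1 (i - j%:R)]
     | j : 'I_p & (1 <= j <= (p - 1) %/ 2)%N]
  :|: [set [set pt2 (i + j%:R); pt2 (i - j%:R)]
     | j : 'I_p & (1 <= j <= (p - 1) %/ 2)%N]
  :|: [set [set pt1 i; pt2 i]].

Definition GA_g (i : 'F_p) : {set {set GA_vertex}} :=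
  [set [set pt1 j; pt2 (i + j)] | j : 'F_p].

Definition GA : {set {set {set GA_vertex}}} :=
  [set GA_f i | i : 'F_p] :|: [set GA_g i | i : 'F_p & i != 0].

Definition GA_square : {set 3.-tuple {x : GA_vertex | x != pt2 (-1)}} :=
  factorisation_square GA (pt2 (-1)).

End GA.

(* Main.v *)
Require Import Defs.
From mathcomp Require Import all_boot all_order all_algebra all_fingroup.
From mathcomp Require Import ring zify.

(** Write [v] for the deleted vertex [(-1, 2)] and [L] for the square. Since [L]
    is symmetric, and since exchanging columns and symbols inverts the
    permutation of each row, the six conjugates fall into two classes.

    If symbols play the role of rows (two conjugates), the row of [k] is the
    involution fixing [k] and exchanging the ends of the other edges of the
    1-factor through [k] and [v]. If two such involutions map [C] onto the same
    set [E], both exchange [C] and [E], hence preserve their union and their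
    intersection, and the intersection is nonempty because it contains [k]; as
    [GA] is perfect, both are everything. So these two are row-Hamiltonian.

    The other four are row-Hamiltonian together or not at all. With rows
    [(-1, 1)] and [(0, 2)], the columns [(-1, 1)], [(0, 1)], [(1, 1)], [(0, 2)],
    [(-2, 2)] contain the same five symbols in both rows. For [p = 3] these are
    all columns, and a finite check shows that every row cycle is full; for
    [p > 3] the column [(2, 1)] is missing. *)

Set Implicit Arguments.
Unset Strict Implicit.
Unset Printing Implicit Defensive.

Import GRing.Theory.
Local Open Scope ring_scope.

(** * Edges and 1-factors of [GA] *)

Lemma eq_set2 (T : finType) (a b c d : T) :
  ([set a; b] == [set c; d]) =
    ((a == c) && (b == d)) || ((a == d) && (b == c)).
Proof.
apply/eqP/orP => [eqS|[] /andP[/eqP-> /eqP->]] //; last by rewrite setUC.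
have: a \in [set c; d] by rewrite -eqS set21.
have: b \in [set c; d] by rewrite -eqS set22.
have: c \in [set a; b] by rewrite eqS set21.
have: d \in [set a; b] by rewrite eqS set22.
rewrite !in_set2 (eq_sym c a) (eq_sym c b) (eq_sym d a) (eq_sym d b).
do 4![case: (_ == _)] => //=; by [left|right].
Qed.

Section Factors.

Variable p : nat.
Hypotheses (p_prime : prime p) (p_odd : odd p).

Local Notation V := (GA_vertex p).

Lemma natrp_eq0 n : (n%:R == 0 :> 'F_p) = (p %| n)%N.
Proof. by rewrite (dvdn_pcharf (pchar_Fp p_prime)). Qed.

Lemma Fp2_neq0 : 2%:R != 0 :> 'F_p.
Proof.
rewrite natrp_eq0; apply/negP => /dvdn_leq-/(_ isT).
by move: (prime_gt1 p_prime) p_odd; case: p => [|[|[|]]].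
Qed.

Lemma addrr_eq0 (a : 'F_p) : (a + a == 0) = (a == 0).
Proof. by rewrite -mulr2n -mulr_natl mulf_eq0 (negPf Fp2_neq0). Qed.

Lemma addrr_inj (a b : 'F_p) : (a + a == b + b) = (a == b).
Proof.
by rewrite -subr_eq0 -[RHS]subr_eq0 -[RHS]addrr_eq0; congr (_ == 0); ring.
Qed.

Lemma Fp_halfK (a : 'F_p) : a / 2%:R + a / 2%:R = a.
Proof. by field; exact: Fp2_neq0. Qed.

Lemma vertexE (x y : V) : (x == y) = (x.1 == y.1) && (x.2 == y.2).
Proof. by []. Qed.

(** 1-factors are labelled by pairs: [(i + i, false)] stands for [f_i] and
    [(i, true)] for [g_i]; doubling the index avoids dividing by two. *)
Definition color (x y : V) : 'F_p * bool :=
  if (x.2 == y.2) || (x.1 == y.1) then (x.1 + y.1, false)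
  else (if x.2 then x.1 - y.1 else y.1 - x.1, true).

(** The other end of the edge at [x] in the 1-factor labelled [c]. The label [(0, true)] would stand
    for [g_0], which is not in [GA]: it consists of the vertical edges [(a, 1)(a, 2)], and these lie
    in the [f_a]. Hence the hypotheses [c != (0, true)] below. *)
Definition partner (c : 'F_p * bool) (x : V) : V :=
  if c.2 then (if x.2 then x.1 - c.1 else x.1 + c.1, ~~ x.2)
  else if x.1 + x.1 == c.1 then (x.1, ~~ x.2) else (c.1 - x.1, x.2).

Lemma colorC x y : color x y = color y x.
Proof.
rewrite /color (eq_sym x.2) (eq_sym x.1) addrC; case: ifPn => // /norP[ne2 _].
by case: x.2 y.2 ne2 => [] [].
Qed.

Lemma color_valid x y : color x y != (0, true).
Proof.
rewrite /color; case: ifPn => [_|/norP[_ ne1]]; rewrite xpair_eqE ?andbF //.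
by rewrite andbT; case: ifP; rewrite subr_eq0 // eq_sym.
Qed.

Lemma partner_neq c x : partner c x != x.
Proof.
case: c x => t [] [a b]; rewrite /partner /= vertexE /=.
  by case: b; rewrite andbF.
case: ifP => [_|/negbT]; first by case: b; rewrite andbF.
by rewrite eqxx andbT subr_eq eq_sym.
Qed.

Lemma partnerK c : involutive (partner c).
Proof.
case: c => t [] [a b]; rewrite /partner /=.
  by case: b => /=; congr (_, _); ring.
have [aat|aat] := boolP (a + a == t); rewrite /= ?aat ?negbK //.
have -> : (t - a + (t - a) == t) = false.
  rewrite -subr_eq0 (_ : _ - t = t - (a + a)); last by ring.
  by rewrite subr_eq0 eq_sym (negPf aat).
by congr (_, _); ring.
Qed.

Lemma color_partner c x : c != (0, true) -> color x (partner c x) = c.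
Proof.
case: c x => t [] [a b]; rewrite /color /partner /= ?xpair_eqE.
  rewrite andbT => t0; have -> : (b == ~~ b) = false by case: b.
  case: b => /=; first rewrite -[_ == a - t]subr_eq0 subKr (negPf t0) //.
  by rewrite -[_ == a + t]subr_eq0 opprD addNKr oppr_eq0 (negPf t0) addrC addKr.
have [/eqP <- _|_ _] := boolP (a + a == t); rewrite /= ?eqxx ?orbT //.
by congr (_, _); ring.
Qed.

Lemma partner_color x y : x != y -> partner (color x y) x = y.
Proof.
case: x y => [a b] [a' b'].
rewrite /color /partner /= vertexE /= negb_and => ne.
have [/orP eqab|/norP[bb' aa']] := boolP ((b == b') || (a == a')) => /=.
  rewrite (inj_eq (addrI a)); have [eqa|aa'] := eqVneq a a'.
    by move: ne; rewrite eqa eqxx; case: b b' {eqab} => [] [].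
  by case: eqab => /eqP ab; [rewrite addrC addKr ab | rewrite ab eqxx in aa'].
by case: b b' bb' {ne} => [] [] // _ /=; congr (_, _); ring.
Qed.

Lemma colorP c x y : c != (0, true) -> x != y ->
  (color x y == c) = (y == partner c x).
Proof.
move=> c0 xy; apply/eqP/eqP => [<-|->]; first by rewrite partner_color.
by rewrite color_partner.
Qed.

(** One of the least residues of [d] and [-d] lies in the index range used by [f_i]. *)
Lemma Fp_halfP (d : 'F_p) : d != 0 ->
  exists2 j : 'I_p, (1 <= j <= (p - 1) %/ 2)%N & d = j%:R \/ d = - j%:R.
Proof.
move=> d0; have d_lt : (d < p)%N.
  by have := ltn_ord d; rewrite [X in (_ < X)%N]Fp_cast.
have d_gt : (0 < d)%N.
  by rewrite lt0n; apply: contraNneq d0 => d00; apply/eqP/val_inj.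
have dE : d = (d : nat)%:R by rewrite natr_Zp.
have [le|gt] := leqP d ((p - 1) %/ 2).
  by exists (Ordinal d_lt); [rewrite /= d_gt | left].
have pd_lt : (p - d < p)%N by lia.
exists (Ordinal pd_lt) => /=; first by lia.
right; rewrite natrB ?(ltnW d_lt) // pchar_Fp_0 // -dE; ring.
Qed.

(** Inside a level, the pairs [i + j], [i - j] are those of sum [i + i]. The vertical edge at [a]
    has label [a + a], and doubling is injective since [p] is odd. *)
Lemma mem_GA_f (i : 'F_p) (x y : V) : x != y ->
  ([set x; y] \in GA_f i) = (color x y == (i + i, false)).
Proof.
move=> xy; apply/idP/eqP.
  have edge (P : pred 'I_p) b :
      [set x; y] \in [set [set ((i + j%:R, b) : V); (i - j%:R, b)]
                       | j : 'I_p & P j] ->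
      color x y = (i + i, false).
    case/imsetP => j _ /eqP; rewrite eq_set2 => /orP[]/andP[/eqP-> /eqP->];
    by rewrite /color /= eqxx /=; congr (_, _); ring.
  case/setUP => [/setUP[/edge//|/edge//]|/set1P/eqP].
  by rewrite eq_set2 => /orP[]/andP[/eqP-> /eqP->]; rewrite /color /= eqxx.
have i_mid (j : 'F_p) a a' : 
    a + a' = i + i -> a - i = j -> a = i + j /\ a' = i - j.
  move=> aai <-; split; first ring.
  rewrite (_ : a' = i + i - a); first by ring.
  by rewrite -aai; ring.
case: x y xy => [a b] [a' b']; rewrite /color vertexE negb_and /=.
have [-> /=|bb' /=] := eqVneq b b'.
  rewrite orbF => aa' /eqP; rewrite xpair_eqE andbT => /eqP aai.
  have d0 : a - i != 0.
    apply: contraNneq aa' => /eqP; rewrite subr_eq0 => /eqP ai.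
    by rewrite -(inj_eq (addrI a)) aai ai.
  have [j jP dE] := Fp_halfP d0.
  have sE : [set (a, b'); (a', b')] =
      [set ((i + j%:R, b') : V); (i - j%:R, b')].
    case: dE => dE; have [-> ->] := i_mid _ _ _ aai dE => //.
    by rewrite opprK setUC.
  apply/setUP; left; apply/setUP; rewrite sE.
  by case: b' {sE}; [right|left]; apply/imsetP; exists j; rewrite ?inE.
case: eqP => [<- _ /eqP|//].
rewrite xpair_eqE addrr_inj andbT => /eqP->.
apply/setUP; right; apply/set1P.
by case: b b' bb' => [] [] //; rewrite setUC.
Qed.

Lemma mem_GA_g (i : 'F_p) (x y : V) : i != 0 -> x != y ->
  ([set x; y] \in GA_g i) = (color x y == (i, true)).
Proof.
move=> i0 xy; apply/imsetP/eqP.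
  case=> j _; have jij : (j == i + j) = false.
    by rewrite -[X in X == _]add0r (inj_eq (addIr j)) eq_sym (negPf i0).
  move/eqP; rewrite eq_set2 => /orP[]/andP[/eqP-> /eqP->];
  by rewrite /color /= ?jij ?(eq_sym _ j) ?jij /=; congr (_, _); ring.
case: x y xy => [a b] [a' b']; rewrite /color /=.
case: ifPn => // /norP[bb' aa'] _ /eqP; rewrite xpair_eqE andbT => /eqP.
case: b b' bb' => [] [] // _ <-.
  by exists a'; rewrite // setUC /pt2 subrK.
by exists a; rewrite // /pt2 subrK.
Qed.

Lemma mem_factor_of (x y z w : V) : x != y -> z != w ->
  ([set z; w] \in factor_of (GA p) x y) = (color z w == color x y).
Proof.
move=> xy zw; rewrite /factor_of; case: pickP => [h /andP[hF]|noF] /=.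
  case/setUP: hF => /imsetP[i i0 ->].
    by rewrite !mem_GA_f // => /eqP->.
  by rewrite inE in i0; rewrite !mem_GA_g // => /eqP->.
(* The default value of [factor_of] cannot occur: the colour of [x] and [y] names a factor that
   contains their edge. *)
have := color_valid x y; case Exy: (color x y) => [t []] t0.
  have := noF (GA_g t); rewrite mem_GA_g ?Exy ?eqxx ?andbT; last first.
    - by [].
    - by apply: contraNneq t0 => ->.
  by case/setUP; right; apply: imset_f; rewrite inE; apply: contraNneq t0 => ->.
have := noF (GA_f (t / 2%:R)); rewrite mem_GA_f // Exy Fp_halfK // eqxx andbT.
by case/setUP; left; apply: imset_f.
Qed.

(** * Perfection of [GA] *)

(** As [p] is prime, any nonzero [d] generates the additive group: [y] is reached from [b] in as
    many steps as the least residue of [(y - b) / d]. *)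
Lemma translation_closed (B : {set 'F_p}) d b y : d != 0 ->
  (forall x, x \in B -> x + d \in B) -> b \in B -> y \in B.
Proof.
move=> d0 BD bB; rewrite (_ : y = b + d *+ ((y - b) / d : 'F_p)); last first.
  by rewrite -mulr_natr natr_Zp mulrC divfK // addrC subrK.
elim: (nat_of_ord _) => [|n IHn]; first by rewrite mulr0n addr0.
by rewrite mulrSr addrA BD.
Qed.

(** The composite of two reflections is the translation by [t - s]. *)
Lemma reflections_closed (B : {set 'F_p}) s t b y : s != t ->
  (forall x, x \in B -> s - x \in B) -> (forall x, x \in B -> t - x \in B) ->
  b \in B -> y \in B.
Proof.
move=> st Bs Bt; apply: (@translation_closed _ (t - s)).
  by rewrite subr_eq0 eq_sym.
by move=> x /Bs/Bt; congr (_ \in B); ring.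
Qed.

Lemma partner_g_closed (A : {set V}) t :
  (forall x, x \in A -> partner (t, true) x \in A) ->
  forall a, ((a, false) \in A) = ((a + t, true) \in A).
Proof.
by move=> At a; apply/idP/idP => /At; rewrite /partner /= ?addrK.
Qed.

(** A factor [g_t] matches the two levels, so [A] is determined by its trace on the first one; it
    suffices that this trace is empty or full. *)
Lemma g_closed_full (A : {set V}) t x y :
  (forall z, z \in A -> partner (t, true) z \in A) ->
  (forall a a', (a, false) \in A -> (a', false) \in A) ->
  x \in A -> y \in A.
Proof.
case: x y => [a b] [a' b'] /partner_g_closed At Afull aA.
have {a b aA} Afalse z : (z, false) \in A.
  case: b aA; last exact: Afull.
  by rewrite -[a](subrK t) -At; apply: Afull.
by case: b'; first by rewrite -[a'](subrK t) -At.
Qed.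

(** In other words, the union of two distinct 1-factors is connected: [GA] is
    a perfect 1-factorisation. *)
Lemma partner_connected (A : {set V}) c c' x y :
  c != (0, true) -> c' != (0, true) -> c != c' ->
  (forall z, z \in A -> partner c z \in A) ->
  (forall z, z \in A -> partner c' z \in A) ->
  x \in A -> y \in A.
Proof.
(* A factor of each kind: carried to the first level along [g_t], the reflection of the second level
   becomes [a -> s - t - t - a]. It differs from [a -> s - a] because [t + t] is nonzero. At a
   centre of reflection, where [partner] changes level instead, there is nothing to prove. *)
have fg s t : t != 0 ->
    (forall z, z \in A -> partner (s, false) z \in A) ->
    (forall z, z \in A -> partner (t, true) z \in A) -> x \in A -> y \in A.
  move=> t0 As /[dup] At' /partner_g_closed At.
  apply: (g_closed_full _ At') => b z bA; pose B := [set a | (a, false) \in A].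
  suff : z \in B by rewrite inE.
  apply: (@reflections_closed B s (s - t - t) b); last by rewrite inE.
  - rewrite -subr_eq0 (_ : _ - _ = t + t); last by ring.
    by rewrite addrr_eq0.
  - move=> a; rewrite !inE => /[dup] aA /As; rewrite /partner /=.
    by case: eqP => [<- _|//]; rewrite addrK.
  - move=> a; rewrite !inE => /[dup]; rewrite {1}At => aA; move: (As _ aA).
    rewrite /partner /= !At; case: eqP => [<- _|_]; last first.
      by move=> sA _; rewrite (_ : _ - a + t = s - (a + t)) //; ring.
    by move=> _; rewrite (_ : _ - a + t = a + t) //; ring.
case: c c' => s [] [t []] s0 t0 st As At.
(* Two factors [g]: going along one and back along the other translates the first level by
   [s - t]. *)
- apply: (g_closed_full _ At) => b z bA; pose B := [set a | (a, false) \in A].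
  suff : z \in B by rewrite inE.
  apply: (@translation_closed B (s - t) b); last by rewrite inE.
    by apply: contraNneq st => /eqP; rewrite subr_eq0 => /eqP->.
  move=> a; rewrite !inE (partner_g_closed As) (partner_g_closed At).
  by rewrite (_ : _ + t = a + s) //; ring.
- by apply: fg At As; apply: contraNneq s0 => ->.
- by apply: fg As At; apply: contraNneq t0 => ->.
have {}st : s != t by apply: contraNneq st => ->.
(* Two factors [f]: the union [B1] and the intersection [B2] of the traces of [A] on the levels are
   stable under both reflections. So [B1] is full and contains the centre [s / 2]; there the first
   factor changes level, which puts [s / 2] in [B2], and [B2] is full too. *)
pose B1 := [set a | ((a, false) \in A) || ((a, true) \in A)].
pose B2 := [set a | ((a, false) \in A) && ((a, true) \in A)].
have B1_refl u : (forall z, z \in A -> partner (u, false) z \in A) ->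
    forall a, a \in B1 -> u - a \in B1.
  move=> Au a; rewrite !inE => /orP[] /Au; rewrite /partner /=;
  by case: eqP => [<-|_ ->]; rewrite ?addrK ?orbT // => ->; rewrite ?orbT.
have B2_refl u : (forall z, z \in A -> partner (u, false) z \in A) ->
    forall a, a \in B2 -> u - a \in B2.
  move=> Au a; rewrite !inE => /andP[] /Au; rewrite /partner /=.
  move=> aA /Au; move: aA; rewrite /partner /=.
  by case: eqP => [<-|_ -> ->//]; rewrite addrK => -> ->.
move=> xA; have xB1 : x.1 \in B1.
  by rewrite inE; case: x xA {fg} => a [] /= ->; rewrite ?orbT.
have sB2 : s / 2%:R \in B2.
  have : s / 2%:R \in B1.
    by apply: reflections_closed st (B1_refl _ As) (B1_refl _ At) xB1.
  rewrite !inE => /orP[] /[dup] /As;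
  rewrite /partner /= Fp_halfK eqxx;
  by move=> -> ->.
have : y.1 \in B2.
  by apply: reflections_closed st (B2_refl _ As) (B2_refl _ At) sB2.
by rewrite inE => /andP[]; case: y {fg} => a [].
Qed.

End Factors.

(** * Latin squares as functions, and their row cycles *)

Section LatinFunctions.

Variable S : finType.
Implicit Types (f g : S -> S -> S) (M : {set 3.-tuple S}) (C A : {set S}).

Definition represents f M :=
  forall r c k, ([tuple r; c; k] \in M) = (k == f r c).

(** For a Latin square, equal images mean that [C] is stable under the permutation taking row [r] to
    row [s]; the condition says that this permutation is a single cycle. *)
Definition row_transitive f : Prop := forall r s C,
  r != s -> C != set0 -> f r @: C = f s @: C -> C = setT.

Lemma represents_latin f M : represents f M ->
  (forall r, injective (f r)) -> (forall c, injective (f^~ c)) ->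
  latin_square M.
Proof.
move=> fM injr injc; apply/and3P; split; apply/forallP=> a; apply/forallP=> b;
  apply/cards1P.
- by exists (f a b); apply/setP=> k; rewrite !inE fM.
- have [h hK Kh] := injF_bij (injr a); exists (h b); apply/setP=> c.
  by rewrite !inE fM -{1}(Kh b) (inj_eq (injr a)) eq_sym.
- have [h hK Kh] := injF_bij (injc a); exists (h b); apply/setP=> r.
  by rewrite !inE fM -{1}(Kh b) (inj_eq (injc a)) eq_sym.
Qed.

Lemma represents_subrectangle f M r s C : represents f M ->
  subrectangle M r s C = [&& r != s, C != set0 & f r @: C == f s @: C].
Proof.
move=> fM; rewrite /subrectangle.
suff symE t : symbols M t C = f t @: C by rewrite !symE.
apply/setP=> k; rewrite inE; apply/exists_inP/imsetP => -[c cC].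
  by rewrite fM => /eqP ->; exists c.
by move=> ->; exists c; rewrite // fM.
Qed.

(** Every subrectangle contains a minimal one, which is a row cycle; if the row cycles are full, so
    are all subrectangles. *)
Lemma row_hamiltonianP f M : represents f M -> latin_square M ->
  row_hamiltonian M <-> row_transitive f.
Proof.
move=> fM latM; rewrite /row_hamiltonian latM /=.
split=> [/forallP hamM r s C rs C0 eqC | tr].
  have subC : subrectangle M r s C.
    by rewrite (represents_subrectangle _ _ _ fM) rs C0 eqC eqxx.
  have [D /minsetP[subD minD] DC] := minset_exists subC.
  suff cycD : row_cycle M r s D.
    have /forallP/(_ D)/implyP/(_ cycD) := forallP (hamM r) s.
    move/eqP=> cardD; apply/eqP; rewrite -subTset; apply: subset_trans DC.
    by rewrite subTset eqEcard subsetT cardsT cardD leqnn.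
  rewrite /row_cycle subD; apply/forallP=> E; apply/implyP => /andP[ED nDE].
  by apply: contra nDE => subE; rewrite (minD E).
apply/forallP=> r; apply/forallP=> s; apply/forallP=> C; apply/implyP.
case/andP; rewrite (represents_subrectangle _ _ _ fM).
by case/and3P=> rs C0 /eqP eqC _; rewrite (tr r s C) ?cardsT.
Qed.

(** The common image of [C] in rows [r] and [s] of [f] has the common image [C] in the same rows of
    [g]. So it is everything, and [C] has at least as many elements. *)
Lemma row_transitive_inv f g : (forall r, cancel (f r) (g r)) ->
  row_transitive g -> row_transitive f.
Proof.
move=> fK tr r s C rs C0 eqC.
have gf t : g t @: (f t @: C) = C.
  by rewrite -imset_comp (eq_imset _ (fK t)) imset_id.
have fC : f r @: C = setT.
  apply: (tr r s); rewrite ?gf ?eqC ?gf //.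
  by have /set0Pn[x xC] := C0; apply/set0Pn; exists (f s x); apply: imset_f.
apply/eqP; rewrite eqEcard subsetT /= -fC; exact: leq_imset_card.
Qed.

Lemma involutions_transitive (s s' : S -> S) k C :
  involutive s -> involutive s' -> s k = k ->
  (forall A, A != set0 -> (forall x, x \in A -> s x \in A) ->
     (forall x, x \in A -> s' x \in A) -> A = setT) ->
  C != set0 -> s @: C = s' @: C -> C = setT.
Proof.
move=> sK s'K sk tr C0 eqC; set E := s @: C in eqC.
have CE x : (s x \in E) = (x \in C) by rewrite mem_imset //; apply: inv_inj.
have CE' x : (s' x \in E) = (x \in C).
  by rewrite eqC mem_imset //; apply: inv_inj.
have EC x : (s x \in C) = (x \in E) by rewrite -CE sK.
have EC' x : (s' x \in C) = (x \in E) by rewrite -CE' s'K.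
have UT : C :|: E = setT.
  apply: tr => [|x|x]; rewrite ?inE ?CE ?EC ?CE' ?EC' 1?orbC //.
  by rewrite setU_eq0 (negPf C0).
(* The point [k] lies in [C] or in [E]; as [s] exchanges these two sets and fixes [k], it lies in
   both. *)
have kCE : k \in C :&: E.
  have := in_setT k; rewrite -UT !inE => /orP[] kC; rewrite kC /= ?andbT.
    by rewrite -sk CE.
  by rewrite -sk EC.
have IT : C :&: E = setT.
  apply: tr => [|x|x]; rewrite ?inE ?CE ?EC ?CE' ?EC' 1?andbC //.
  by apply/set0Pn; exists k.
by apply/eqP; rewrite -subTset -IT subsetIl.
Qed.

(** Without fixed points [A] splits into pairs [x], [s x]; the induction removes one pair at a
    time. *)
Lemma involution_even (s : S -> S) A : involutive s ->
  (forall x, x \in A -> s x \in A) -> (forall x, x \in A -> s x != x) ->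
  ~~ odd #|A|.
Proof.
move=> sK; have [n] := ubnP #|A|; elim: n A => // n IHn A leA sA sneq.
have [->|/set0Pn[x xA]] := eqVneq A set0; first by rewrite cards0.
have sxA : s x \in A :\ x by rewrite !inE sneq ?sA.
move: leA; rewrite (cardsD1 x) xA (cardsD1 (s x)) sxA /= negbK => leA.
apply: IHn => [|y|y]; first by rewrite ltnW.
  rewrite !inE => /and3P[ysx yx yA]; rewrite sA // andbT.
  by rewrite (inj_eq (inv_inj sK)) yx (can2_eq sK sK) ysx.
by rewrite !inE => /and3P[_ _ /sneq].
Qed.

End LatinFunctions.

(** * The six conjugates of a symmetric square *)

Lemma ord3_ind (P : 'I_3 -> Prop) : P 0 -> P 1 -> P 2%:R -> forall i, P i.
Proof.
move=> P0 P1 P2 [[|[|[|//]]] i3].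
- by rewrite (_ : Ordinal i3 = 0) //; apply: val_inj.
- by rewrite (_ : Ordinal i3 = 1) //; apply: val_inj.
- by rewrite (_ : Ordinal i3 = 2%:R) //; apply: val_inj.
Qed.

(** These [sigma] give the conjugates whose rows are indexed by the symbols of the original square.
    They are the transposition of 0 and 2 and one 3-cycle. *)
Lemma card_perm3_fix : #|[set sigma : 'S_3 | sigma 0 == 2%:R]| = 2%N.
Proof.
pose s1 : 'S_3 := tperm 0 2%:R.
pose s2 : 'S_3 := (s1 * tperm 0%R 1%R)%g.
have tp := (tpermL, tpermR, @tpermD).
have s1E : [/\ s1 0 = 2%:R, s1 1 = 1 & s1 2%:R = 0] by rewrite /s1 !tp.
have s2E : [/\ s2 0 = 2%:R, s2 1 = 0 & s2 2%:R = 1].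
  by case: s1E => e0 e1 e2; rewrite !permM e0 e1 e2 !tp.
case: s1E s2E => [e0 e1 e2] [e0' e1' e2'].
suff -> : [set sigma : 'S_3 | sigma 0 == 2%:R] = [set s1; s2].
  rewrite cards2 (_ : s1 != s2) //; apply/eqP => /permP/(_ 1).
  by rewrite e1 e1'.
apply/setP=> s; rewrite !inE; apply/eqP/orP => [s0|[] /eqP->] //.
have s10 : s 1 != 2%:R by rewrite -s0 (inj_eq perm_inj).
have s20 : s 2%:R != 2%:R by rewrite -{2}s0 (inj_eq perm_inj).
have s12 : s 1 != s 2%:R by rewrite (inj_eq perm_inj).
have [[s1E s2E]|[s1E s2E]] :
    (s 1 = 0 /\ s 2%:R = 1) \/ (s 1 = 1 /\ s 2%:R = 0).
- move: s10 s20 s12; elim/ord3_ind: (s 1); elim/ord3_ind: (s 2%:R) => //;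
  by [left|right].
- by right; apply/eqP/permP; apply: ord3_ind; rewrite ?s0 ?s1E ?s2E.
by left; apply/eqP/permP; apply: ord3_ind; rewrite ?s0 ?s1E ?s2E.
Qed.

Section Conjugates.

Variables (S : finType) (L : {set 3.-tuple S}) (f g : S -> S -> S).
Hypotheses (fL : represents f L) (fC : forall i j, f i j = f j i).
Hypotheses (fK : forall i, cancel (f i) (g i)).
Hypotheses (gK : forall i, cancel (g i) (f i)).

Lemma mem_latin_conjugate (sigma : 'S_3) (u : 3.-tuple S) :
  ([tuple tnth u (sigma i) | i < 3] \in latin_conjugate sigma L) = (u \in L).
Proof.
pose h (e : 3.-tuple S) := [tuple tnth e (sigma i) | i < 3].
suff h_inj : injective h by exact: (mem_imset _ u h_inj).
move=> u1 u2 equ; apply: eq_from_tnth => i.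
have := congr1 (fun u => tnth u (sigma^-1 i)%g) equ.
by rewrite !tnth_mktuple permKV.
Qed.

(** As [f] is symmetric, the conjugates are represented in pairs by [f], by its row inverse [g], and
    by [fun k i => g i k], where symbols act as rows. The first two are row-transitive together, the
    third by hypothesis. *)
Lemma row_hamiltonian_conjugate (sigma : 'S_3) :
  row_transitive (fun k i => g i k) ->
  row_hamiltonian (latin_conjugate sigma L) <->
  sigma 0 = 2%:R \/ row_transitive f.
Proof.
move=> trg.
have fg i j k : (k == f i j) = (j == g i k).
  by apply/eqP/eqP => ->; rewrite ?fK ?gK.
(* By symmetry [fun i => g i k] is an involution: it exchanges [i] and [j] when [f i j = k]. *)
have gg i k : g (g i k) k = i.
  by apply/eqP; rewrite eq_sym -fg fC gK.
have inj_f r : injective (f r) by apply: can_inj (fK r).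
have inj_g r : injective (g r) by apply: can_inj (gK r).
have inj_f' c : injective (f^~ c) by move=> i j; rewrite /= !(fC _ c) => /inj_f.
have inj_g' c : injective (g^~ c).
  by apply: (@can_inj _ _ _ (g^~ c)) => i; rewrite gg.
have ham h : represents h (latin_conjugate sigma L) ->
    (forall r, injective (h r)) -> (forall c, injective (h^~ c)) ->
    row_hamiltonian (latin_conjugate sigma L) <-> row_transitive h.
  by move=> hL i1 i2; apply: row_hamiltonianP (represents_latin hL i1 i2).
have trfg : row_transitive f <-> row_transitive g.
  by split; apply: row_transitive_inv.
have mem_conj r c k u :
    (forall i : 'I_3, tnth [tuple r; c; k] i = tnth u (sigma i)) ->
   ([tuple r; c; k] \in latin_conjugate sigma L) = (u \in L).
  move=> E; rewrite -(mem_latin_conjugate sigma).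
  have -> // : [tuple r; c; k] = [tuple tnth u (sigma i) | i < 3].
  by apply: eq_from_tnth => i; rewrite tnth_mktuple E.
have s01 : sigma 0 != sigma 1 by rewrite (inj_eq perm_inj).
have s02 : sigma 0 != sigma 2%:R by rewrite (inj_eq perm_inj).
have s12 : sigma 1 != sigma 2%:R by rewrite (inj_eq perm_inj).
have mem3 r c k a0 a1 a2 :
    tnth [tuple a0; a1; a2] (sigma 0) = r ->
    tnth [tuple a0; a1; a2] (sigma 1) = c ->
    tnth [tuple a0; a1; a2] (sigma 2%:R) = k ->
   ([tuple r; c; k] \in latin_conjugate sigma L) = (a2 == f a0 a1).
  move=> E0 E1 E2; rewrite -fL; apply: mem_conj.
  by apply: ord3_ind; rewrite ?E0 ?E1 ?E2.
(* Injectivity leaves six triples of values of [sigma], treated in lexicographic order. *)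
move: s01 s02 s12 mem3; elim/ord3_ind: (sigma 0);
  elim/ord3_ind: (sigma 1); elim/ord3_ind: (sigma 2%:R) => // _ _ _ mem3.
- have [r c k| | | to from] := ham f; rewrite ?(mem3 _ _ _ r c k) //.
  by split=> [/to|[//|/from]]; [right|].
- have [r c k| | | to from] := ham g; rewrite ?(mem3 _ _ _ r k c) ?fg //.
  by split=> [/to/trfg|[//|/trfg/from]]; [right|].
- have [r c k| | | to from] := ham f; rewrite ?(mem3 _ _ _ c r k) 1?fC //.
  by split=> [/to|[//|/from]]; [right|].
- have [r c k| | | to from] := ham g; rewrite ?(mem3 _ _ _ k r c) 1?fC ?fg //.
  by split=> [/to/trfg|[//|/trfg/from]]; [right|].
- have [r c k| | | _ from] := ham (fun k i => g i k);
    rewrite ?(mem3 _ _ _ c k r) ?fg //.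
  by split=> _; [left | apply: from].
- have [r c k| | | _ from] := ham (fun k i => g i k);
    rewrite ?(mem3 _ _ _ k c r) 1?fC ?fg //.
  by split=> _; [left | apply: from].
Qed.

End Conjugates.

(** * The Latin square of [GA] at a vertex *)

Section Square.

Variable p : nat.
Hypotheses (p_prime : prime p) (p_odd : odd p).

Local Notation V := (GA_vertex p).

Section Vertex.

Variable v : V.
Local Notation S := {x : V | x != v}.

(** Both [sq_val] and its row inverse [div_val] are defined on all of [V], so that they can be
    evaluated without proofs of [x != v]. *)
Definition sq_val (x y : V) : V := if x == y then x else partner (color x y) v.
Definition div_val (x z : V) : V := if x == z then x else partner (color z v) x.

Lemma sq_val_neq x y : x != v -> sq_val x y != v.
Proof.
by move=> xv; rewrite /sq_val; case: ifP => // _; apply: partner_neq.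
Qed.

Lemma div_val_neq x z : x != v -> z != v -> div_val x z != v.
Proof.
move=> xv zv; rewrite /div_val; case: ifPn => //; apply: contraNneq => xz.
by rewrite -(partnerK (color z v) x) xz colorC partner_color // eq_sym.
Qed.

Definition sq (x y : S) : S :=
  exist _ (sq_val (val x) (val y)) (sq_val_neq _ (valP x)).
Definition sq_div (x z : S) : S :=
  exist _ (div_val (val x) (val z)) (div_val_neq (valP x) (valP z)).

Lemma sqC x y : sq x y = sq y x.
Proof.
apply: val_inj; rewrite /= /sq_val eq_sym colorC.
by case: eqP.
Qed.

Lemma sqK x : cancel (sq x) (sq_div x).
Proof.
move=> y; apply: val_inj => /=; rewrite /sq_val /div_val.
have [->|xy] := eqVneq (val x) (val y); first by rewrite eqxx.
have [xE|_] := eqVneq.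
  have := valP y.
  rewrite /= -(partner_color xy).
  by rewrite -[X in _ != X](partnerK (color (val x) (val y))) -xE eqxx.
rewrite colorC color_partner ?partner_color //.
exact: color_valid.
Qed.

Lemma sq_divK x : cancel (sq_div x) (sq x).
Proof.
move=> z; apply: val_inj => /=; rewrite /sq_val /div_val.
have [->|xz] := eqVneq (val x) (val z); first by rewrite eqxx.
rewrite eq_sym (negPf (partner_neq _ _)) color_partner ?color_valid //.
by rewrite colorC partner_color // eq_sym; exact: (valP z).
Qed.

Lemma represents_sq : represents sq (factorisation_square (GA p) v).
Proof.
move=> i j k; rewrite inE !(tnth_nth i) /=.
rewrite -(inj_eq val_inj) -[RHS](inj_eq val_inj) /= /sq_val.
case: eqVneq => [_|ij]; first by rewrite (inj_eq val_inj).
rewrite mem_factor_of ?(valP k) // colorC colorP ?color_valid //.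
by rewrite eq_sym (valP k).
Qed.

(** On [V], the involution [sq_div^~ k] follows the 1-factor through [k] and [v], except at [k],
    which it fixes instead of sending to [v]. *)
Lemma sq_div_closed (k : S) (A : {set S}) x :
  (forall x, x \in A -> sq_div x k \in A) ->
  x \in [set val y | y in A] -> x != val k ->
  partner (color (val k) v) x \in [set val y | y in A].
Proof.
move=> Ak /imsetP[y yA ->] yk; apply/imsetP.
exists (sq_div y k); first exact: Ak.
by rewrite /= /div_val (negPf yk).
Qed.

Lemma sq_div_invol k : involutive (fun i => sq_div i k).
Proof.
move=> i; apply: val_inj; rewrite /= /div_val.
have [->|ik] := eqVneq (val i) (val k); first by rewrite eqxx.
case: eqP => [E|_]; last by rewrite partnerK.
have := valP i; rewrite /= -[X in X != _](partnerK (color (val k) v)) E.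
by rewrite partner_color ?eqxx ?(valP k).
Qed.

Lemma row_transitive_symbols : row_transitive (fun k i : S => sq_div i k).
Proof.
move=> k k' C kk' C0; apply: (@involutions_transitive _ _ _ k) C0.
- exact: sq_div_invol.
- exact: sq_div_invol.
- by apply: val_inj; rewrite /= /div_val eqxx.
move=> A A0 Ak Ak'.
have fixed (l : S) : sq_div l l = l by apply: val_inj; rewrite /= /div_val eqxx.
(* [k] is the only fixed point of [sq_div^~ k], so that the parity of [#|A|]
   decides whether [k] is in [A], and likewise for [k']; without this, [A] with
   or without [v] need not be closed under both [partner] maps. *)
have parity (l : S) :
    (forall x, x \in A -> sq_div x l \in A) -> odd #|A| = (l \in A).
  move=> Al; have [lA|lA] := boolP (l \in A).
    rewrite (cardsD1 l) lA /= (negPf (involution_even (sq_div_invol l) _ _)) //.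
      move=> x; rewrite !inE => /andP[xl xA]; rewrite Al // andbT.
      apply: contraNneq xl => E; rewrite -(sq_div_invol l x) /= E.
      by rewrite fixed.
    move=> x; rewrite !inE => /andP[xl _].
    rewrite -(inj_eq val_inj) /= /div_val.
    by rewrite (inj_eq val_inj) (negPf xl) partner_neq.
  apply/negbTE/(involution_even (sq_div_invol l)) => // x xA.
  rewrite -(inj_eq val_inj) /= /div_val (inj_eq val_inj).
  have [xl|_] := eqVneq x l; last exact: partner_neq.
  by rewrite -xl xA in lA.
have kA : (k \in A) = (k' \in A) by rewrite -!parity.
(* The vertex [v] is added exactly when its neighbour [k] is in [A]; as [k] and [k'] are both in [A]
   or both outside, this makes [B] closed under both 1-factors, and perfection applies. *)
pose B := [set val y | y in A] :|: [set x | (x == v) && (k \in A)].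
have Bclosed l :
    (forall x, x \in A -> sq_div x l \in A) -> (l \in A) = (k \in A) ->
    forall x, x \in B -> partner (color (val l) v) x \in B.
  move=> Al lk x; have [->|xl] := eqVneq x (val l).
    rewrite partner_color ?(valP l) // inE mem_imset ?lk; last exact: val_inj.
    by rewrite !inE eqxx => /orP[->|/andP[_ ->]]; rewrite orbT.
  case/setUP => [xA|]; first by rewrite inE sq_div_closed.
  rewrite inE => /andP[/eqP-> kA'].
  rewrite colorC partner_color 1?eq_sym ?(valP l) //.
  by rewrite inE mem_imset ?lk ?kA' //; apply: val_inj.
have /set0Pn[a aA] := A0.
have aB : val a \in B by rewrite inE mem_imset ?aA //; exact: val_inj.
have cc' : color (val k) v != color (val k') v.
  apply: contraNneq kk' => E; apply/eqP/val_inj.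
  have vk : v != val k by rewrite eq_sym (valP k).
  have vk' : v != val k' by rewrite eq_sym (valP k').
  by rewrite -(partner_color vk) -(partner_color vk') colorC E colorC.
apply/eqP; rewrite -subTset; apply/subsetP => y _.
have := partner_connected p_prime p_odd (val y)
  (color_valid _ _) (color_valid _ _) cc'
  (Bclosed k Ak erefl) (Bclosed k' Ak' (esym kA)) aB.
rewrite inE mem_imset; last exact: val_inj.
by rewrite !inE (negPf (valP y)) orbF.
Qed.

(** If rows [r] and [s] carry the same symbols in [C], then [C] is stable under passing from a
    column [c] to the column where row [s] has the symbol of row [r] in [c]. So [C] contains the
    orbit of each of its elements. *)
Lemma row_transitive_traject n :
  (forall r s x y, r != v -> s != v -> r != s -> x != v -> y != v ->
     y \in traject (fun c => div_val s (sq_val r c)) x n) ->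
  row_transitive sq.
Proof.
move=> full r s C rs /set0Pn[x xC] eqC; apply/eqP; rewrite -subTset.
apply/subsetP => y _.
have /trajectP[m _ yE] := full (val r) (val s) (val x) (val y)
  (valP r) (valP s) rs (valP x) (valP y).
suff [z zC zE] : exists2 z, z \in C &
    val z = iter m (fun c => div_val (val s) (sq_val (val r) c)) (val x).
  by rewrite (val_inj (etrans yE (esym zE))).
elim: m {yE} => [|m [z zC zE]]; first by exists x.
have : sq r z \in sq s @: C by rewrite -eqC imset_f.
case/imsetP => z' z'C zz'; exists z' => //.
by rewrite iterS -zE -(sqK s z') -zz'.
Qed.

End Vertex.

Lemma row_hamiltonian_GA_conjugate (sigma : 'S_3) :
  row_hamiltonian (latin_conjugate sigma (GA_square p)) <->
  sigma 0 = 2%:R \/ row_transitive (@sq (pt2 (-1))).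
Proof.
apply: row_hamiltonian_conjugate (row_transitive_symbols (v := pt2 (-1))).
- exact: represents_sq.
- exact: sqC.
- exact: sqK.
- exact: sq_divK.
Qed.

(** * Values of the square, and a short row cycle when [p > 3] *)

Local Notation v := (pt2 (-1) : V).

(** The sum [-2] is excluded because it labels [f_(-1)], which joins [v] to [(-1, 1)]; any other [f]
    acts on [v] by reflection. *)
Lemma sq_val11 (a b : 'F_p) : a != b -> a + b != - 2%:R ->
  sq_val v (pt1 a) (pt1 b) = pt2 (a + b + 1).
Proof.
move=> ab ab2; rewrite /sq_val vertexE (negPf ab) /color /partner /=.
rewrite (_ : -1 + -1 = - 2%:R) ?(eq_sym _ (a + b)) ?(negPf ab2); last by ring.
by rewrite opprK.
Qed.

Lemma sq_val12 (a b : 'F_p) : a != b ->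
  sq_val v (pt1 a) (pt2 b) = pt1 (a - b - 1).
Proof.
move=> ab; rewrite /sq_val vertexE (negPf ab) /color /partner /= (negPf ab) /=.
by congr (_, _); ring.
Qed.

Lemma sq_val12_diag (a : 'F_p) : a != -1 ->
  sq_val v (pt1 a) (pt2 a) = pt2 (a + a + 1).
Proof.
move=> a1; rewrite /sq_val vertexE andbF /color /partner /= eqxx /=.
by rewrite (addrr_inj p_prime p_odd) eq_sym (negPf a1) opprK.
Qed.

Lemma sq_val22 (a b : 'F_p) : a != b -> a + b = - 2%:R ->
  sq_val v (pt2 a) (pt2 b) = pt1 (-1).
Proof.
move=> ab ab2; rewrite /sq_val vertexE (negPf ab) /color /partner /= ab2.
by rewrite (_ : -1 + -1 = - 2%:R) ?eqxx //; ring.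
Qed.

Lemma not_row_transitive_sq : p != 3%N -> ~ row_transitive (@sq v).
Proof.
move=> p3 tr.
have n1 : 1 != 0 :> 'F_p by exact: oner_neq0.
have n2 : 2%:R != 0 :> 'F_p by exact: Fp2_neq0.
have n3 : 3%:R != 0 :> 'F_p.
  by rewrite (natrp_eq0 p_prime) (@dvdn_prime2 p 3%N).
have neqF (a b c : 'F_p) : c != 0 -> a - b = c -> a != b.
  by move=> c0 abc; rewrite -subr_eq0 abc.
have ne1 (a : 'F_p) : (pt1 a : V) != v by rewrite vertexE andbF.
have ne2 (a : 'F_p) : a + 1 != 0 -> (pt2 a : V) != v.
  by move=> a1; rewrite vertexE /= andbT -subr_eq0 opprK.
pose e1 a : {x : V | x != v} := exist (fun x : V => x != v) _ (ne1 a).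
have h0 : 0 + 1 != 0 :> 'F_p by rewrite add0r.
have h1 : 1 + 1 != 0 :> 'F_p by [].
have h2 : - 2%:R + 1 != 0 :> 'F_p.
  by apply: contraNneq n1; rewrite -oppr_eq0 => <-; apply/eqP; ring.
pose e20 : {x : V | x != v} := exist (fun x : V => x != v) _ (ne2 0 h0).
pose e21 : {x : V | x != v} := exist (fun x : V => x != v) _ (ne2 1 h1).
pose e22 : {x : V | x != v} := exist (fun x : V => x != v) _ (ne2 _ h2).
(* Passing from a column to the one where row [e20] has the symbol of row [e1 (-1)] runs through
   [e1 (-1)], [e22], [e1 1], [e1 0], [e20] and closes up. *)
pose C := [set e1 (-1); e1 0; e1 1; e20; e22].
have r1 : sq (e1 (-1)) (e1 (-1)) = e1 (-1).
  by apply: val_inj; rewrite /= /sq_val eqxx.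
have r2 : sq (e1 (-1)) (e1 0) = e20.
  apply: val_inj; rewrite /= sq_val11; first by rewrite addr0 addNr.
    by rewrite oppr_eq0.
  by apply: neqF n1 _; ring.
have r3 : sq (e1 (-1)) (e1 1) = e21.
  apply: val_inj; rewrite /= sq_val11; first by rewrite addNr add0r.
    by rewrite eq_sym; apply: neqF n2 _; ring.
  by apply: neqF n2 _; ring.
have r4 : sq (e1 (-1)) e20 = e1 (- 2%:R).
  apply: val_inj; rewrite /= sq_val12; first by congr (_, _); ring.
  by rewrite oppr_eq0.
have r5 : sq (e1 (-1)) e22 = e1 0.
  apply: val_inj; rewrite /= sq_val12; first by congr (_, _); ring.
  by apply: neqF n1 _; ring.
have s1 : sq e20 (e1 (-1)) = e1 (- 2%:R) by rewrite sqC.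
have s2 : sq e20 (e1 0) = e21.
  rewrite sqC; apply: val_inj; rewrite /= sq_val12_diag.
    by rewrite !add0r.
  by rewrite eq_sym oppr_eq0.
have s3 : sq e20 (e1 1) = e1 0.
  rewrite sqC; apply: val_inj; rewrite /= sq_val12 //.
  by congr (_, _); ring.
have s4 : sq e20 e20 = e20.
  by apply: val_inj; rewrite /= /sq_val eqxx.
have s5 : sq e20 e22 = e1 (-1).
  apply: val_inj; rewrite /= sq_val22 ?add0r //.
  by rewrite eq_sym oppr_eq0.
have CT : C = setT.
  apply: (tr (e1 (-1)) e20).
  - by rewrite -(inj_eq val_inj) /= vertexE andbF.
  - by apply/set0Pn; exists e20; rewrite !inE eqxx !orbT.
  rewrite !imsetU !imset_set1 r1 r2 r3 r4 r5 s1 s2 s3 s4 s5.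
  by apply/setP => x; rewrite !inE; do 5![case: (_ == _) => //=].
(* Column [e1 2] differs from [e1 (-1)] because 3 is nonzero modulo [p]; this is where [p != 3]
   enters. *)
have := in_setT (e1 2%:R); rewrite -CT !inE -!(inj_eq val_inj) /= !vertexE /=.
have [m1 m2 m3] :
    [/\ 2%:R != -1 :> 'F_p, 2%:R != 0 :> 'F_p & 2%:R != 1 :> 'F_p].
  split=> //; first by apply: neqF n3 _; ring.
  by apply: neqF n1 _; ring.
by rewrite (negPf m1) (negPf m2) (negPf m3) !andbF.
Qed.

End Square.

(** * The case [p = 3], and the count of conjugates *)

Lemma row_transitive_sq3 : row_transitive (@sq 3%N (pt2 (-1))).
Proof.
pose v : GA_vertex 3%N := pt2 (-1).
pose vs : seq (GA_vertex 3%N) :=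
  [seq (a, b) | a <- [:: 0; 1; 2%:R], b <- [:: false; true]].
have vsP x : x \in vs.
  case: x => a b; apply/allpairsP; exists (a, b); split=> //=; last by case: b.
  by case: a => -[|[|[|//]]].
(* The order is 5, so a single cycle is exhausted by a trajectory of length 5. Over an explicit list
   of vertices the claim is a closed boolean, decided by evaluation. *)
have cycle_vs : all (fun r => all (fun s => all (fun x => all (fun y =>
    [|| r == v, s == v, r == s, x == v, y == v
      | y \in traject (fun c => div_val v s (sq_val v r c)) x 5%N])
    vs) vs) vs) vs by vm_compute.
apply: (@row_transitive_traject _ _ 5%N) => r s x y rv sv rs xv yv.
move: cycle_vs => /allP/(_ r (vsP r))/allP/(_ s (vsP s)).
move=> /allP/(_ x (vsP x))/allP/(_ y (vsP y)).
by rewrite (negPf rv) (negPf sv) (negPf rs) (negPf xv) (negPf yv) !orFb.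
Qed.

Local Close Scope ring_scope.

Theorem theorem6 (p : nat) (hp : prime p) (hodd : odd p) :
  (p = 3 -> atomic (GA_square p)) /\ (p <> 3 -> nu (GA_square p) = 2).
Proof.
have ham := row_hamiltonian_GA_conjugate hp hodd.
split=> [p3|/eqP p3]; rewrite /atomic /nu.
  (* Here 6 is the number of all permutations of the coordinates: every conjugate qualifies. *)
  rewrite -[RHS](card_Sn 3) -cardsT; apply: eq_card => sigma; rewrite !inE.
  by apply/ham; right; rewrite p3; apply: row_transitive_sq3.
rewrite -[RHS]card_perm3_fix; apply: eq_card => sigma; rewrite !inE.
apply/idP/eqP => [/ham[//|] tr|s0]; last by apply/ham; left.
by case: (not_row_transitive_sq hp hodd p3 tr).
Qed.
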